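(* Let $S$ be a Borel space, let $\mathcal M_0$ be a measurable subset of $\mathcal M_*(S)$, and let $s\mapsto\mathcal R_s$ be a probability kernel from $S$ to $\mathcal M_\pm(S)$ such that for every $\mu\in\mathcal M_0$, $$\mathcal R_s\bigl(\{\nu\in\mathcal M_\pm(S):\nu+\mu\in\mathcal M_0\}\bigr)=1\quad\text{for }\mu\text{-a.e. } s\in S.$$ Let $(X_n)_{n=0}^\infty$ be the Pólya urn process in $S$ with random replacements (possibly with subtractions) defined by $\mathcal R$ and $\mathcal M_0$, with an initial state $X_0\in\mathcal M_0$. Then there exists a Pólya urn process $(\widetilde X_n)_{n=0}^\infty$ in $S\times[0,1]$ with deterministic replacements (possibly with subtractions), with set of admissible states $\widetilde{\mathcal M}_0=\{\mu\times\lambda:\mu\in\mathcal M_0\}\subseteq\mathcal M_*(S\times[0,1])$, such that $\widetilde X_n=X_n\times\lambda$, and thus $X_n=\pi^\sharp(\widetilde X_n)$, for every $n\ge0$. Here $\lambda$ is Lebesgue measure on $[0,1]$, $\pi:S\times[0,1]\to S$ is the projection, and $\pi^\sharp(\nu)(B)=\nu(\pi^{-1}(B))$.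
   Context: A measurable space is a Borel space if it is isomorphic (as a measurable space) to a Borel subset of $[0,1]$. The interval $[0,1]$ carries its Borel $\sigma$-field and $S\times[0,1]$ the product $\sigma$-field. For a measurable space $(T,\mathcal T)$, let $\mathcal M_\pm(T)$ be the set of finite signed measures on $T$, $\mathcal M(T)$ the set of finite (non-negative) measures, $\mathcal M_*(T)=\{\mu\in\mathcal M(T):\mu\ne 0\}$, and $\mathcal P(T)$ the set of probability measures; each is a measurable space with the $\sigma$-field generated by the maps $\mu\mapsto\mu(B)$, $B\in\mathcal T$. A probability kernel from $S_1$ to $S_2$ is a measurable map $S_1\to\mathcal P(S_2)$. For $\mu\in\mathcal M_*(T)$ write $\mu'=\mu/\mu(T)$. If $T$ is a Borel space, then $\mathcal M(T)$ is a measurable subset of $\mathcal M_\pm(T)$. Pólya urn process in a Borel space $T$ with deterministic replacements, possibly with subtractions: given a measurable set $\mathcal N_0\subseteq\mathcal M_*(T)$ (the set of admissible states) and a measurable map $s\mapsto R_s$ from $T$ to $\mathcal M_\pm(T)$ such that for every $\mu\in\mathcal N_0$, $R_s+\mu\in\mathcal N_0$ for $\mu$-a.e. $s$, let $\widehat R_\mu\in\mathcal P(\mathcal N_0)$, $\mu\in\mathcal N_0$, be the distribution of $\mu+R_s$ when $s$ has distribution $\mu'$. Then $\widehat R$ is a probability kernel from $\mathcal N_0$ to itself, and the urn process is the Markov chain in $\mathcal N_0$ with a given deterministic initial state in $\mathcal N_0$ and transition kernel $\widehat R$. Pólya urn process in a Borel space $T$ with random replacements, possibly with subtractions: given a measurable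 set $\mathcal N_0\subseteq\mathcal M_*(T)$ and a probability kernel $s\mapsto\mathcal R_s$ from $T$ to $\mathcal M_\pm(T)$ such that for every $\mu\in\mathcal N_0$, $\mathcal R_s(\{\nu\in\mathcal M_\pm(T):\nu+\mu\in\mathcal N_0\})=1$ for $\mu$-a.e. $s$, let, for $\mu\in\mathcal N_0$ and measurable $B\subseteq\mathcal N_0$, $$\widehat R_\mu(B)=\int_T \mathcal R_s\bigl(\{\nu\in\mathcal M_\pm(T):\mu+\nu\in B\}\bigr)\,d\mu'(s).$$ Then $\widehat R$ is a probability kernel from $\mathcal N_0$ to itself, and the urn process is the Markov chain in $\mathcal N_0$ with a given deterministic initial state in $\mathcal N_0$ and transition kernel $\widehat R$. A Markov chain $(X_n)_{n\ge0}$ with transition kernel $\widehat R$ is one satisfying $\mathbb P(X_n\in B\mid X_0,\dots,X_{n-1})=\widehat R_{X_{n-1}}(B)$ a.s. for all $n\ge1$ and all measurable $B$. *)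

(* Defs.v *)
From HB Require Import structures.
From mathcomp Require Import all_boot all_order all_algebra.
From mathcomp Require Import all_classical all_reals all_analysis.
From mathcomp Require Import measurable_realfun.

Set Implicit Arguments.
Unset Strict Implicit.
Unset Printing Implicit Defensive.

Import Order.TTheory GRing.Theory Num.Theory.
Import numFieldNormedType.Exports.

Local Open Scope classical_set_scope.
Local Open Scope ring_scope.
Local Open Scope ereal_scope.

(* Charges and measures are total functions [set T -> \bar R] whose values on
   non-measurable sets are unconstrained, so identity of (signed) measures is
   agreement on measurable sets, not Leibniz equality.                        *)
Definition agree d (T : measurableType d) (R : realType)
    (m1 m2 : set T -> \bar R) : Prop :=
  forall A, measurable A -> m1 A = m2 A.

Section signed_measures.
Context d (T : measurableType d) (R : realType).

Definition signed_measure : Type := {charge set T -> \bar R}.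

HB.instance Definition _ := gen_eqMixin signed_measure.
HB.instance Definition _ := gen_choiceMixin signed_measure.
HB.instance Definition _ := isPointed.Build signed_measure czero.

Definition signed_measure_evals : set (set signed_measure) :=
  \bigcup_(B in measurable)
    preimage_set_system setT (fun nu : signed_measure => nu B) measurable.

HB.instance Definition _ :=
  Measurable.copy signed_measure (g_sigma_algebraType signed_measure_evals).

End signed_measures.

Section finite_measures.
Context d (T : measurableType d) (R : realType).

Definition fin_measure : Type := {finite_measure set T -> \bar R}.

HB.instance Definition _ := gen_eqMixin fin_measure.
HB.instance Definition _ := gen_choiceMixin fin_measure.
HB.instance Definition _ := isPointed.Build fin_measure mzero.

Definition fin_measure_evals : set (set fin_measure) :=
  \bigcup_(B in measurable)
    preimage_set_system setT (fun mu : fin_measure => mu B) measurable.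

HB.instance Definition _ :=
  Measurable.copy fin_measure (g_sigma_algebraType fin_measure_evals).

(* This set is measurable, so its measurable subsets are the measurable sets of
   finite measures that it contains.                                          *)
Definition nonzero_measures : set fin_measure := [set mu | ~ agree mu mzero].

End finite_measures.

(* [D] is the Borel subset of [0, 1]; since [D] is measurable, its trace
   sigma-algebra consists of the measurable sets included in [D], so the last
   two clauses say that [f] and its inverse [D -> T] are measurable.          *)
Definition borel_space d (T : measurableType d) (R : realType) : Prop :=
  exists (D : set R) (f : T -> R),
    [/\ measurable D, D `<=` `[0%R, 1%R], set_bij setT D f,
        measurable_fun setT f &
        forall A : set T, measurable A -> measurable (f @` A)].

Section unit_interval.
Variable R : realType.

Definition unit_itv : Type := {x : R | (0 <= x <= 1)%R}.

HB.instance Definition _ := Choice.on unit_itv.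

Let zero_in_itv : (0 <= 0 :> R)%R && (0 <= 1 :> R)%R.
Proof. by rewrite lexx ler01. Qed.

HB.instance Definition _ :=
  isPointed.Build unit_itv (exist _ 0%R zero_in_itv).

HB.instance Definition _ := Measurable.copy unit_itv
  (g_sigma_algebra_preimageType (val : unit_itv -> R)).

Definition leb01 (B : set unit_itv) : \bar R := lebesgue_measure (val @` B).

Lemma image_val_itv (A : set R) :
  val @` ((val : unit_itv -> R) @^-1` A) = A `&` `[0%R, 1%R].
Proof.
apply/seteqP; split => [_ [x Ax <-]|x [Ax xI]].
  by split => //=; rewrite in_itv /=; exact: (valP x).
move: xI; rewrite /= in_itv /= => xI.
by exists (exist _ x xI).
Qed.

Lemma measurable_image_val (B : set unit_itv) :
  measurable B -> measurable (val @` B).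
Proof.
case=> A mA <-; rewrite setTI image_val_itv.
by apply: measurableI => //; exact: measurable_itv.
Qed.

Let leb01_0 : leb01 set0 = 0.
Proof. by rewrite /leb01 image_set0 measure0. Qed.

Let leb01_ge0 B : 0 <= leb01 B.
Proof. exact: measure_ge0. Qed.

Let leb01_sigma_additive : semi_sigma_additive leb01.
Proof.
move=> F mF tF mUF; rewrite /leb01 image_bigcup.
apply: measure_semi_sigma_additive.
- by move=> i; exact: measurable_image_val.
- move=> i j _ _ [_ [[x Fx <-] [y Fy /val_inj yx]]].
  by apply: tF => //; exists x; split => //; rewrite -yx.
- by rewrite -image_bigcup; exact: measurable_image_val.
Qed.

HB.instance Definition _ :=
  isMeasure.Build _ _ _ leb01 leb01_0 leb01_ge0 leb01_sigma_additive.

Let leb01_setT : leb01 setT = 1.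
Proof.
rewrite /leb01 -(preimage_setT val) image_val_itv setTI.
by rewrite lebesgue_measure_itv /= lte_fin ltr01 oppr0 adde0.
Qed.

HB.instance Definition _ :=
  Measure_isProbability.Build _ _ _ leb01 leb01_setT.

End unit_interval.
Arguments leb01 {R}.

Section markov_chains.
Context d (T : measurableType d) dO (Omega : measurableType dO) (R : realType).
Variable P : probability Omega R.

(* [Y] is a version of P(E | G); [G] is meant to be a sub-sigma-algebra.      *)
Definition cond_prob_version (G : set (set Omega)) (E : set Omega)
    (Y : Omega -> \bar R) : Prop :=
  [/\ forall U, measurable U -> G (Y @^-1` U),
      P.-integrable setT Y &
      forall A, G A -> \int[P]_(w in A) Y w = P (A `&` E)].

Definition history (X : nat -> Omega -> T) (n : nat) : set (set Omega) :=
  <<s \bigcup_(i in [set i | (i <= n)%N])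
        preimage_set_system setT (X i) measurable >>.

(* Markov chain in the measurable subset [N0] of [T]; [K] is only relevant on
   states in [N0] and measurable subsets of [N0].                             *)
Definition markov_chain (N0 : set T) (K : T -> set T -> \bar R)
    (X : nat -> Omega -> T) : Prop :=
  [/\ forall n, measurable_fun setT (X n),
      forall n w, N0 (X n w) &
      forall n (B : set T), measurable B -> B `<=` N0 ->
        exists2 Y, cond_prob_version (history X n) (X n.+1 @^-1` B) Y &
                   {ae P, forall w, Y w = K (X n w) B}].

End markov_chains.

Section polya_urns.
Context d (T : measurableType d) (R : realType).
Local Notation M := (fin_measure T R).
Local Notation Mpm := (signed_measure T R).

(* The set of nu with mu + nu in B: the sum, a priori a signed measure, has to
   be a finite measure that belongs to B.                                     *)
Definition shift_in (B : set M) (mu : M) : set Mpm :=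
  [set nu | exists2 m : M, B m &
     agree m ((mu : set T -> \bar R) \+ (nu : set T -> \bar R))].

(* On nonzero measures, [mnormalize mu point] is mu / mu(T); the default value
   [point] is only used for the zero measure.                                 *)
Definition random_urn_kernel (Rk : R.-pker T ~> Mpm) (mu : M) (B : set M) :
    \bar R :=
  \int[mnormalize mu point]_s Rk s (shift_in B mu).

Definition det_urn_kernel (Rd : T -> Mpm) (mu : M) (B : set M) : \bar R :=
  mnormalize mu point [set s | shift_in B mu (Rd s)].

Definition urn_process dO (Omega : measurableType dO)
    (P : probability Omega R) (N0 : set M) (K : M -> set M -> \bar R)
    (X : nat -> Omega -> M) : Prop :=
  markov_chain P N0 K X /\
  exists2 x0, N0 x0 & forall w, agree (X 0%N w) x0.

Definition det_urn dO (Omega : measurableType dO)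
    (P : probability Omega R) (N0 : set M) (Rd : T -> Mpm)
    (X : nat -> Omega -> M) : Prop :=
  [/\ borel_space T R,
      (measurable N0 /\ N0 `<=` @nonzero_measures _ T R),
      measurable_fun setT Rd,
      forall mu, N0 mu -> {ae mu, forall s, shift_in N0 mu (Rd s)} &
      urn_process P N0 (det_urn_kernel Rd) X].

(* Closed under [agree], as every measurable set of measures is; the plain image
   of [N0] under [mu |-> mu \x leb01] is not.                                  *)
Definition lifted_states (N0 : set M) : set (fin_measure (T * unit_itv R)%type R) :=
  [set m | exists2 mu, N0 mu & agree m (mu \x leb01)].

End polya_urns.

(* Main.v *)
From HB Require Import structures.
Require Import Defs.
From mathcomp Require Import all_boot all_order all_algebra.
From mathcomp Require Import all_classical all_reals all_analysis.
From mathcomp Require Import measurable_realfun lra.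

(** The coordinate of [[0, 1]] in the colour space carries the randomness of the
replacement.  A kernel K from S to a standard Borel space is the law of
[h (s, U)] with U uniform on [[0, 1]] and h measurable.  Applied to [Rk] this
gives a signed measure [r (s, u)] with law [Rk s] under Lebesgue measure
[lambda] in u, and the deterministic replacement is
[Rd (s, u) = r (s, u) \x lambda].  If the state is [mu \x lambda], a ball
(s, u) drawn from its normalisation has s drawn from [mu / mu(S)] and u uniform
and independent of s, so that the new state [(mu + r (s, u)) \x lambda] has the
law of [(mu + nu) \x lambda] with nu drawn from [Rk s]
([lifted_urn_kernel]).  Multiplication by [lambda] is injective with measurable
inverse, the projection, so that [X n \x lambda] has the same histories as
[X n] and is the required chain on the same probability space.

The work is in the randomisation, for which the space of signed measures on S
must be seen to be standard Borel.  This is done by explicit codes.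
- A Borel space is used in the form of a retract: measurable maps
  [f : T -> [0, 1]] and [g : R -> T] with [g (f t) = t].  Countably many reals
  are coded by one ([encode], [decode]), by writing the bits [q < x i], q
  rational, as ternary digits 0 and 2.
- A finite measure on [[0, 1]] is a multiple of the image of [lambda] under a
  quantile function that depends measurably on the masses of countably many
  half-lines ([quantile_law]).  The same formula decodes a finite measure from a
  sequence of reals, with no condition on the sequence ([decode_measureK]), and
  randomises a kernel ([random_code_law]).
- A signed measure is coded through its Jordan decomposition.  This is
  measurable because the positive part of A is the supremum of the values
  [nu (A `&` C n)] over a countable family [C] that approximates every
  measurable set for every finite measure ([jpos_sup]).  The same supremum shows
  that the condition of positivity of [mu + nu], implicit in [shift_in], is
  measurable in nu ([measurable_shift_in]). *)

Set Implicit Arguments.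
Unset Strict Implicit.
Unset Printing Implicit Defensive.

Import Order.TTheory GRing.Theory Num.Theory.
Import numFieldNormedType.Exports.

Local Open Scope classical_set_scope.
Local Open Scope ring_scope.

(** * Coding sequences of reals by one real *)

Section countable_sup.
Context d (T : measurableType d) (R : realType).
Local Open Scope ereal_scope.

(** A supremum exceeds x exactly when one of the countably many terms does. *)
Lemma measurable_countable_sup (I : countType) (f : I -> T -> \bar R) :
  (forall i, measurable_fun setT (f i)) ->
  measurable_fun setT (fun t => ereal_sup (range (f ^~ t))).
Proof.
move=> mf; apply: (measurability _ (ErealGenOInfty.measurableE R)) => //.
move=> _ [_ [x ->] <-]; rewrite setTI.
rewrite [X in measurable X](_ : _ = \bigcup_(i in setT) (f i @^-1` `]x%:E, +oo[)).
  apply: countable_bigcupT_measurable => // i.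
  by rewrite -[X in measurable X]setTI; apply: mf => //; exact: emeasurable_itv.
apply/seteqP; split => t /=.
  rewrite in_itv/= andbT => /ereal_sup_gt[_ [i _ <-]] xf.
  by exists i => //=; rewrite in_itv/= andbT.
move=> [i _ /=]; rewrite !in_itv/= !andbT => /lt_le_trans; apply.
by apply: ereal_sup_ubound; exists i.
Qed.

End countable_sup.

Section ternary.
Variable R : realType.
Implicit Types (b : nat -> bool) (x : R).

Fixpoint ternary_sum n b : R :=
  if n is m.+1 then ((b 0%N)%:R *+ 2 + ternary_sum m (b \o S)) / 3%:R else 0.

(** The point of the Cantor set with ternary digits 0 and 2 according to [b]. *)
Definition ternary b : R := limn (ternary_sum ^~ b).

(** Reading digits off any real: on the Cantor set the first digit is 2 exactly
above 1/2, and [3 x - 0] or [3 x - 2] is the point with the remaining digits.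
Off the Cantor set the result is meaningless but still measurable in [x]. *)
Fixpoint digit n x : bool :=
  if n is m.+1 then digit m (3%:R * x - (2%:R^-1 < x)%R%:R *+ 2) else 2%:R^-1 < x.

Lemma ternary_sum_ge0 n b : 0 <= ternary_sum n b.
Proof. by elim: n b => //= n IH b; rewrite divr_ge0// addr_ge0// mulrn_wge0. Qed.

Lemma ternary_sum_le1 n b : ternary_sum n b <= 1.
Proof.
elim: n b => //= n IH b; rewrite ler_pdivrMr// mul1r.
by have := IH (b \o S); case: (b 0%N) => /=; lra.
Qed.

Lemma nondecreasing_ternary_sum b : nondecreasing_seq (ternary_sum ^~ b).
Proof.
apply/nondecreasing_seqP => n; elim: n b => [|n IH] b; first exact: ternary_sum_ge0.
by rewrite [leLHS]/= [leRHS]/= ler_pM2r ?invr_gt0// lerD2l; exact: IH.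
Qed.

Lemma cvg_ternary_sum b : ternary_sum ^~ b @ \oo --> ternary b.
Proof.
apply: nondecreasing_is_cvgn; first exact: nondecreasing_ternary_sum.
by exists 1 => _ [n _ <-]; exact: ternary_sum_le1.
Qed.

Lemma ternary_itv b : 0 <= ternary b <= 1.
Proof.
have cb := @cvg_ternary_sum b; apply/andP; split.
  by apply: limr_ge; [apply/cvg_ex; eexists; exact: cb|
    apply: nearW => n; exact: ternary_sum_ge0].
by apply: limr_le; [apply/cvg_ex; eexists; exact: cb|
    apply: nearW => n; exact: ternary_sum_le1].
Qed.

(** The self-similarity of the Cantor set. *)
Lemma ternaryS b : ternary b = ((b 0%N)%:R *+ 2 + ternary (b \o S)) / 3%:R.
Proof.
have := @cvg_ternary_sum b; rewrite -cvg_shiftS => h.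
apply: (cvg_unique _ h) => //=.
by apply: cvgMr_tmp; apply: cvgD; [exact: cvg_cst|exact: cvg_ternary_sum].
Qed.

Lemma digit_ternary n b : digit n (ternary b) = b n.
Proof.
have first_digit b' : (2%:R^-1 < ternary b') = b' 0%N.
  rewrite ternaryS; have := @ternary_itv (b' \o S).
  by case: (b' 0%N) => /= h; [apply/idP|apply/negbTE; rewrite -leNgt]; lra.
elim: n b => [|n IH] b; first exact: first_digit.
rewrite /= first_digit -[RHS]/((b \o S) n) -IH; congr digit.
by rewrite [ternary b]ternaryS mulrC divfK// [_ + ternary _]addrC addrK.
Qed.

Lemma measurable_bool_mulrn d (T : measurableType d) (c : T -> bool) k :
  measurable_fun setT c -> measurable_fun setT (fun t => (c t)%:R *+ k : R).
Proof.
move=> mc; apply: (eq_measurable_fun (fun t => if c t then k%:R else 0 : R)).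
  by move=> t _; case: (c t); rewrite ?mul0rn.
exact: measurable_fun_ifT.
Qed.

Lemma measurable_digit n : measurable_fun setT (digit n).
Proof.
have m0 : measurable_fun setT (fun x : R => 2%:R^-1 < x).
  exact: measurable_fun_ltr.
elim: n => [|n IH] //=.
apply: (measurableT_comp IH); apply: measurable_funB.
  exact: measurable_funM.
exact: measurable_bool_mulrn.
Qed.

Lemma measurable_ternary d (T : measurableType d) (b : T -> nat -> bool) :
  (forall n, measurable_fun setT (b ^~ n)) ->
  measurable_fun setT (ternary \o b).
Proof.
move=> mb; apply: (@measurable_fun_cvg _ _ _ _ (fun n t => ternary_sum n (b t))).
  move=> n; elim: n b mb => [|n IH] b mb //=.
  apply: measurable_funM => //; apply: measurable_funD; last first.
    by apply: (IH (fun t => b t \o S)) => m; exact: mb.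
  exact: measurable_bool_mulrn.
by move=> t _; exact: cvg_ternary_sum.
Qed.

End ternary.

Section real_code.
Variables (R : realType) (I : countType).

(** A family of reals as a single bit sequence, listing the Dedekind cuts of its
members along the enumeration of [I * rat]. *)
Definition cut_bits (x : I -> R) (n : nat) : bool :=
  if @unpickle (I * rat)%type n is Some p then ratr p.2 < x p.1 else false.

Definition encode (x : I -> R) : R := ternary R (cut_bits x).

(** Recovers the i-th real as the supremum of the rationals in its lower cut. *)
Definition decode (y : R) (i : I) : R :=
  fine (ereal_sup (range (fun q : rat =>
    if digit (pickle (i, q)) y then (ratr q : R)%:E else -oo%E))).

Lemma encode_itv x : 0 <= encode x <= 1.
Proof. exact: ternary_itv. Qed.

Lemma encodeK x : decode (encode x) = x.
Proof.
apply/funext => i; rewrite /decode; set A := (X in ereal_sup X).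
suff -> : ereal_sup A = (x i)%:E by [].
have AE q : A (if ratr q < x i then (ratr q : R)%:E else -oo%E).
  by exists q => //; rewrite /encode digit_ternary /cut_bits pickleK.
apply/eqP; rewrite eq_le; apply/andP; split.
  apply: ge_ereal_sup => _ [q _ <-]; rewrite /encode digit_ternary /cut_bits pickleK /=.
  by case: ifPn => [/ltW|_]; rewrite ?leNye.
rewrite leNgt; apply/negP => supx.
suff [q] : exists q : rat, (ereal_sup A < (ratr q : R)%:E)%E /\ ratr q < x i.
  move=> [supq qx]; have := AE q; rewrite qx => /ereal_sup_ubound.
  by move=> /(lt_le_trans supq); rewrite ltxx.
have rat_below (r : R) : r < x i -> exists q : rat, r < ratr q /\ ratr q < x i.
  by move=> /rat_in_itvoo[q]; rewrite in_itv/= => /andP[rq qx]; exists q.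
case: (ereal_sup A) supx => [r||] //=.
  by rewrite lte_fin => /rat_below.
have [|q [_ qx] _] := rat_below (x i - 1); first by rewrite ltrBlDr ltrDl.
by exists q; rewrite ltNyr.
Qed.

Lemma measurable_encode d (T : measurableType d) (x : T -> I -> R) :
  (forall i, measurable_fun setT (x ^~ i)) ->
  measurable_fun setT (encode \o x).
Proof.
move=> mx; apply: (@measurable_ternary _ _ _ (fun t => cut_bits (x t))) => n.
rewrite /cut_bits; case: unpickle => [[i q]|]; last exact: measurable_cst.
by apply: measurable_fun_ltr.
Qed.

Lemma measurable_decode i : measurable_fun setT (decode ^~ i).
Proof.
apply: measurableT_comp; first exact: fine_measurable.
apply: measurable_countable_sup => q.
by apply: measurable_fun_ifT => //; exact: measurable_digit.
Qed.

End real_code.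

(** * Borel spaces as measurable retracts of the unit interval *)

Section real_retracts.
Variable R : realType.

(** Standard Borel structure without reference to an image set: [f] codes points of
[T] by reals in the unit interval and [g], defined on the whole line, decodes
them.  Measurability of the range of [f] is then automatic, since the range is
the set where [f (g r) = r]. *)
Definition real_retract d (T : measurableType d) (f : T -> R) (g : R -> T) :=
  [/\ measurable_fun setT f, measurable_fun setT g, cancel f g &
      forall t, 0 <= f t <= 1].

(** The inverse of the coding, extended by a constant outside the Borel image. *)
Lemma borel_space_retract d (T : measurableType d) :
  borel_space T R -> exists f g, @real_retract d T f g.
Proof.
move=> [D [f [mD D01 [fD injf surjf] mf mfA]]].
have f_inj : injective f by move=> x y; apply: injf; rewrite ?in_setT.
pose g r : T := xget point [set t | f t = r].
have gK : cancel f g.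
  move=> t; apply: f_inj; rewrite /g; case: xgetP => [y _ //|noty].
  by exfalso; apply: (noty t).
exists f, g; split => //; last first.
  by move=> t; have /D01 := fD t I; rewrite /= in_itv.
move=> _ A mA; rewrite setTI.
(* [g] is constant off the range of [f], so preimages split along the range. *)
have imgT : measurable (~` (f @` setT)) by apply: measurableC; exact: mfA.
have -> : g @^-1` A = f @` A `|` (~` (f @` setT) `&` [set _ | A point]).
  apply/seteqP; split => [r /= Agr|r].
    have [[t _ tr]|nr] := pselect ((f @` setT) r).
      by left; exists t => //; rewrite -(gK t) tr.
    right; split => //; move: Agr; rewrite /g; case: xgetP => [y _ /= fr|_ //].
    by exfalso; apply: nr; exists y.
  move=> [[t At <-] /=|[nr Ap]]; first by rewrite gK.
  rewrite /= /g; case: xgetP => // y _ /= fr.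
  by exfalso; apply: nr; exists y.
apply: measurableU; first exact: mfA.
have [Ap|nAp] := pselect (A point).
  by rewrite (_ : [set _ | _] = setT) ?setIT//; apply/seteqP; split.
by rewrite (_ : [set _ | _] = set0) ?setI0//; apply/seteqP; split.
Qed.

Lemma retract_borel_space d (T : measurableType d) (f : T -> R) (g : R -> T) :
  real_retract f g -> borel_space T R.
Proof.
move=> [mf mg gK f01].
have mfg : measurable_fun setT (f \o g) by exact: measurableT_comp.
have imE A : f @` A = [set r | f (g r) = r] `&` g @^-1` A.
  apply/seteqP; split => [_ [t At <-]|r [/= fgr Ag]]; first by rewrite /= gK.
  by exists (g r).
have mD : measurable [set r | f (g r) = r].
  rewrite [X in measurable X](_ : _ = setT `&` (fun r => f (g r) == r) @^-1` [set true]).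
    by apply: measurable_fun_eqr.
  by rewrite setTI; apply/seteqP; split => r /= /eqP.
exists [set r | f (g r) = r], f; split => //.
- by move=> r /= <-; rewrite in_itv/=; exact: f01.
- split.
  + by move=> t _ /=; rewrite gK.
  + by move=> x y _ _ /(congr1 g); rewrite !gK.
  + by move=> r /= fr; exists (g r).
- move=> A mA; rewrite imE; apply: measurableI => //.
  by rewrite -[X in measurable X]setTI; exact: mg.
Qed.

Lemma borel_space_prod d1 d2 (T1 : measurableType d1) (T2 : measurableType d2) :
  borel_space T1 R -> borel_space T2 R -> borel_space (T1 * T2)%type R.
Proof.
move=> /borel_space_retract[f1 [g1 [mf1 mg1 gK1 f01]]].
move=> /borel_space_retract[f2 [g2 [mf2 mg2 gK2 f02]]].
pose f (t : T1 * T2) : R := encode (fun b : bool => if b then f1 t.1 else f2 t.2).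
pose g (r : R) := (g1 (decode r true), g2 (decode r false)).
apply: (@retract_borel_space _ _ f g); split.
- apply: (@measurable_encode _ _ _ _ (fun t b => if b then f1 t.1 else f2 t.2)).
  by case; apply: measurableT_comp.
- by apply: measurable_fun_pair; apply: measurableT_comp => //; exact: measurable_decode.
- by move=> [t1 t2]; rewrite /g /f encodeK gK1 gK2.
- by move=> t; exact: encode_itv.
Qed.

Lemma measurable_unit_val : measurable_fun setT (val : unit_itv R -> R).
Proof. by move=> _ A mA; rewrite setTI; exists A => //; rewrite setTI. Qed.

Lemma borel_space_unit_itv : borel_space (unit_itv R) R.
Proof.
pose pt : {x : R | 0 <= x <= 1} := (point : unit_itv R).
pose g (r : R) : unit_itv R := insubd pt r.
have vg r : val (g r) = if 0 <= r <= 1 then r else 0 by rewrite val_insubd.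
apply: (@retract_borel_space _ (unit_itv R) (val : unit_itv R -> R) g); split.
- exact: measurable_unit_val.
- move=> _ _ [A mA <-]; rewrite !setTI -comp_preimage.
  rewrite -[X in measurable X]setTI.
  apply: (_ : measurable_fun setT (val \o g)) => //.
  apply: (eq_measurable_fun (fun r : R => if 0 <= r <= 1 then r else 0)).
    by move=> r _; rewrite /= vg.
  apply: measurable_fun_ifT => //.
  by apply: measurable_and; exact: measurable_fun_ler.
- by move=> u; rewrite /g valKd.
- by move=> u; exact: (valP u).
Qed.

End real_retracts.

(** * Measures on the unit interval as images of Lebesgue measure *)

Local Open Scope ereal_scope.

Section image_of_finite_measure.
Context d1 d2 (T1 : measurableType d1) (T2 : measurableType d2) (R : realType).
Variables (mu : fin_measure T1 R) (f : T1 -> T2).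
Hypothesis mf : measurable_fun setT f.

Let image : set T2 -> \bar R := pushforward mu f.

Let image0 : image set0 = 0. Proof. exact: measure0. Qed.

Let image_ge0 A : 0 <= image A. Proof. exact: measure_ge0. Qed.

Let image_sigma_additive : semi_sigma_additive image.
Proof. exact: (@measure_semi_sigma_additive _ _ _ (pushforward mu f)). Qed.

HB.instance Definition _ := isMeasure.Build _ _ _ image
  image0 image_ge0 image_sigma_additive.

Let image_finite : fin_num_fun image.
Proof.
move=> A mA; apply: fin_num_measure.
by rewrite -[X in measurable X]setTI; exact: mf.
Qed.

HB.instance Definition _ := @Measure_isFinite.Build _ _ _ image image_finite.

Definition finite_image : fin_measure T2 R := image.

Lemma finite_imageE A : finite_image A = mu (f @^-1` A).
Proof. by []. Qed.

End image_of_finite_measure.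

Section quantiles.
Variable R : realType.

(** Half-lines with rational end points, and the whole line for the total mass. *)
Definition tail_set (o : option rat) : set R :=
  if o is Some q then `]ratr q, +oo[ else setT.

Definition tails d (T : measurableType d) (f : T -> R) (mu : set T -> \bar R)
  (o : option rat) : R := fine (mu (f @^-1` tail_set o)).

(** For [x] the tails of a measure of total mass m on the unit interval and [u] in
the unit interval, this is the largest r such that the mass of [`]s, +oo[] is
above [m * u] for all s below r.  Rationals below 0 count as 0, so that all terms
of the supremum are nonnegative; for other [x] and [u] the supremum may be
infinite and [fine] sends it to 0. *)
Definition quantile (x : option rat -> R) (u : R) : R :=
  fine (ereal_sup (range (fun q : rat =>
    if (x None * u < x (Some q))%R then (Num.max 0%R (ratr q : R))%:E else 0))).

Lemma measurable_quantile d (T : measurableType d) (x : T -> option rat -> R)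
    (u : T -> R) :
  (forall o, measurable_fun setT (x ^~ o)) -> measurable_fun setT u ->
  measurable_fun setT (fun t => quantile (x t) (u t)).
Proof.
move=> mx mu; apply: measurableT_comp; first exact: fine_measurable.
apply: (@measurable_countable_sup _ _ _ _ (fun (q : rat) t =>
  if (x t None * u t < x t (Some q))%R then (Num.max 0%R (ratr q : R))%:E else 0)).
move=> q; apply: measurable_fun_ifT => //.
by apply: measurable_fun_ltr => //; exact: measurable_funM.
Qed.

Section law.
Variable mu : fin_measure R R.
Hypothesis mu01 : mu (~` `[0%R, 1%R]) = 0.
Let x := tails id mu.

Let le_mu A B : measurable A -> measurable B -> A `<=` B -> mu A <= mu B.
Proof. by move=> mA mB; apply: le_measure; rewrite inE. Qed.

Let measurable_tail o : measurable (tail_set o).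
Proof. by case: o => [q|] //=; exact: measurable_itv. Qed.

Let xE (o : option rat) : (x o)%:E = mu (tail_set o).
Proof.
rewrite /x /tails preimage_id fineK//; exact: fin_num_measure.
Qed.

Let x0 o : (0 <= x o)%R.
Proof. by rewrite -lee_fin xE. Qed.

(** As a condition on [u], exceeding t cuts out an initial interval whose length is
the normalised mass of [`]t, +oo[]; this determines the law of the quantile
function.  The mass of a half-line is the supremum of those of the smaller
rational ones, by continuity from below. *)
Lemma lt_quantile (u t : R) : (0 <= u)%R ->
  (t < quantile x u)%R <-> (t < 0)%R \/ (x None * u)%:E < mu `]t, +oo[%classic.
Proof.
move=> u0; rewrite /quantile; set s := ereal_sup _.
have s0 : 0 <= s.
  apply: le_ereal_sup_tmp; exists (if (x None * u < x (Some 0%Q))%R then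
    (Num.max 0%R (ratr 0%Q : R))%:E else 0); first by exists 0%Q.
  by case: ifP => //; rewrite lee_fin le_max lexx.
have q1 (q : rat) : (x None * u < x (Some q))%R -> (ratr q <= 1 :> R)%R.
  move=> xq; rewrite leNgt; apply/negP => q1.
  suff xq0 : x (Some q) = 0%R.
    by move: xq; rewrite xq0 ltNge mulr_ge0.
  apply: EFin_inj; rewrite xE; apply: (@subset_measure0 _ _ _ mu _ (~` `[0%R, 1%R]) _ _ _ mu01) => //.
  - by apply: measurableC; exact: measurable_itv.
  - move=> r /=; rewrite !in_itv/= andbT => qr /andP[_].
    by rewrite leNgt (lt_trans q1 qr).
have s1 : s <= 1.
  apply: ge_ereal_sup => _ [q _ <-]; case: ifPn => [/q1 q1'|_]; last exact: lee01.
  by rewrite lee_fin ge_max ler01.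
have -> : (t < fine s)%R = (t%:E < s).
  by rewrite -lte_fin fineK// ge0_fin_numE// (le_lt_trans s1) ?ltry.
split.
  move=> /ereal_sup_gt[_ [q _ <-]]; case: ifPn => [xq|_]; last by left.
  rewrite lte_fin lt_max => /orP[t0|tq]; [by left|right].
  rewrite (@lt_le_trans _ _ (x (Some q))%:E) ?lte_fin// xE le_mu//.
  by move=> r /=; rewrite !in_itv/= !andbT; exact: lt_trans.
move=> [t0|xt]; first by rewrite (lt_le_trans _ s0).
(* A half-line starting at some [t + n.+1^-1] already has enough mass, and so
   has one with a rational end point in between. *)
have [q tq xq] : exists2 q : rat, (t < ratr q)%R & (x None * u < x (Some q))%R.
  pose F n : set R := `](t + n.+1%:R^-1)%R, +oo[%classic.
  have UF : \bigcup_n F n = `]t, +oo[%classic.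
    apply/seteqP; split => [r [n _]|r]; rewrite /F /=; rewrite !in_itv/= !andbT.
      by apply: lt_trans; rewrite ltrDl invr_gt0.
    move=> tr; have {}tr : (t < r)%R by exact: tr.
    have [n hn] := ltr_add_invr tr.
    by exists n => //=; rewrite in_itv/= andbT.
  have mF n : measurable (F n) by exact: measurable_itv.
  have cF : mu (F n) @[n --> \oo] --> mu `]t, +oo[%classic.
    rewrite -UF; apply: nondecreasing_cvg_mu => //.
      by rewrite UF; exact: measurable_itv.
    move=> m n mn; apply/subsetPset => r; rewrite /F /= !in_itv/= !andbT.
    by apply: le_lt_trans; rewrite lerD2l lef_pV2 ?posrE// ler_nat ltnS.
  have [n xn] : exists n, (x None * u)%:E < mu (F n).
    apply: contrapT => /forallNP noF; move: xt; apply/negP; rewrite -leNgt.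
    rewrite -(cvg_lim _ cF)//; apply: lime_le; first by apply/cvg_ex; eexists; exact: cF.
    by apply: nearW => n; rewrite leNgt; apply/negP; exact: noF.
  have /rat_in_itvoo[q] : (t < t + n.+1%:R^-1)%R by rewrite ltrDl invr_gt0.
  rewrite in_itv/= => /andP[tq qn]; exists q => //.
  rewrite -lte_fin (lt_le_trans xn)// xE le_mu//.
  by move=> r; rewrite /F /=; rewrite !in_itv/= !andbT; exact: lt_trans.
apply: (@lt_le_trans _ _ (ratr q)%:E); rewrite ?lte_fin//.
apply: le_ereal_sup_tmp; exists (Num.max 0%R (ratr q : R))%:E.
  by exists q => //; rewrite xq.
by rewrite lee_fin le_max lexx orbT.
Qed.

Lemma leb01_lt (y : R) : (0 <= y <= 1)%R ->
  leb01 [set u : unit_itv R | (val u < y)%R] = y%:E.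
Proof.
move=> /andP[y0 y1]; rewrite /leb01.
have -> : val @` [set u : unit_itv R | (val u < y)%R] = `[0%R, y[%classic.
  have -> : [set u : unit_itv R | (val u < y)%R] = (val : unit_itv R -> R) @^-1` `]-oo, y[.
    by apply/seteqP; split => u /=; rewrite in_itv.
  rewrite image_val_itv; apply/seteqP; split => r /=; rewrite !in_itv/=.
    by move=> [ry /andP[-> _]].
  by move=> /andP[r0 ry]; rewrite ry r0 (ltW (lt_le_trans ry y1)).
rewrite lebesgue_measure_itv/= lte_fin; case: ifPn => [_|].
  by rewrite oppr0 adde0.
by rewrite -leNgt => y0'; congr EFin; apply/le_anti; rewrite y0 y0'.
Qed.

(** Both sides are finite measures in B.  They agree on the half-lines by
[lt_quantile], hence on all Borel sets.  Multiplying by the mass instead of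
dividing covers the zero measure. *)
Lemma quantile_law B : measurable B ->
  (x None)%:E * leb01 [set u : unit_itv R | B (quantile x (val u))] = mu B.
Proof.
have mq : measurable_fun setT (fun u : unit_itv R => quantile x (val u)).
  by apply: (@measurable_quantile _ _ (fun=> x)) => //; exact: measurable_unit_val.
pose nu : {measure set R -> \bar R} :=
  mscale (NngNum (x0 None)) (finite_image (leb01 : fin_measure _ R) mq).
move=> mB; rewrite -[LHS]/(nu B).
apply/esym/(measure_unique (@RGenOInfty.G R) (fun n => `](- n%:R)%R, +oo[%classic)) => //.
- exact: RGenOInfty.measurableE.
- move=> _ _ [a ->] [b ->]; exists (Num.max a b); apply/seteqP.
  by split => r /=; rewrite !in_itv/= !andbT gt_max => /andP.
- by move=> i; eexists.
- apply/seteqP; split => // r _ /=.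
  exists (Num.bound `|r|%R) => //=; rewrite in_itv/= andbT ltrNl.
  by rewrite (le_lt_trans (ler_norm _))// normrN archi_boundP.
- move=> _ [t ->].
  rewrite /nu/= /mscale/= (finite_imageE _ mq).
  pose A := (fun u : unit_itv R => quantile x (val u)) @^-1` `]t, +oo[.
  rewrite -[X in _ * X]/(leb01 A).
  have [t0|t0] := ltP t 0%R.
    rewrite (_ : A = setT).
      rewrite probability_setT mule1 xE.
      transitivity (mu (`]t, +oo[ `|` ~` `[0%R, 1%R])).
        apply/esym/measureU0 => //.
        by apply: measurableC; exact: measurable_itv.
      congr (mu _); apply/seteqP; split => // r _.
      have [tr|rt] := ltP t r; [left|right]; rewrite /= in_itv/= ?andbT//.
      by move=> /andP[r0 _]; have := lt_le_trans (le_lt_trans rt t0) r0; rewrite ltxx.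
    apply/seteqP; split => // u _; rewrite /A/= in_itv/= andbT.
    by have /andP[u0 _] := valP u; apply/(lt_quantile _ u0); left.
  pose g : R := fine (mu `]t, +oo[%classic).
  have gE : g%:E = mu `]t, +oo[%classic.
    by rewrite fineK// fin_num_measure//; exact: measurable_itv.
  have g0 : (0 <= g)%R by rewrite -lee_fin gE.
  have gm : (g <= x None)%R.
    by rewrite -lee_fin gE xE le_mu//; exact: measurable_itv.
  rewrite -gE.
  have [m0|m0] := eqVneq (x None) 0%R.
    by rewrite m0 mul0e; congr EFin; apply/le_anti; rewrite g0 -m0 gm.
  have {}m0 : (0 < x None)%R by rewrite lt_def m0 x0.
  rewrite (_ : A = [set u | (val u < g / x None)%R]).
    rewrite leb01_lt -?EFinM; first by rewrite mulrC divfK// gt_eqF.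
    by rewrite divr_ge0//= ler_pdivrMr// mul1r.
  apply/seteqP; split => u; rewrite /A/= in_itv/= andbT ltr_pdivlMr// [(val u * _)%R]mulrC;
    have /andP[u0 _] := valP u.
    by move=> /(lt_quantile _ u0)[]; rewrite -?gE ?lte_fin// ltNge t0.
  by move=> ug; apply/(lt_quantile _ u0); right; rewrite -gE lte_fin.
- move=> k /=.
  by rewrite -ge0_fin_numE//; apply: fin_num_measure; exact: measurable_itv.
Qed.

End law.
End quantiles.

(** * Spaces of measures, and measures on a Borel space decoded from real sequences *)

Section evaluations.
Context d (T : measurableType d) (R : realType).

Lemma measurable_fin_eval B : measurable B ->
  measurable_fun setT (fun mu : fin_measure T R => mu B).
Proof.
move=> mB _ Y mY; rewrite setTI; apply: sub_sigma_algebra.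
by exists B => //; exists Y => //; rewrite setTI.
Qed.

Lemma measurable_signed_eval B : measurable B ->
  measurable_fun setT (fun nu : signed_measure T R => nu B).
Proof.
move=> mB _ Y mY; rewrite setTI; apply: sub_sigma_algebra.
by exists B => //; exists Y => //; rewrite setTI.
Qed.

(** The sigma-algebra on measures is generated by the evaluations. *)
Lemma measurable_to_fin d' (T' : measurableType d') (F : T' -> fin_measure T R) :
  (forall B, measurable B -> measurable_fun setT (fun t => F t B)) ->
  measurable_fun setT F.
Proof.
move=> mF; apply: (measurability (@fin_measure_evals _ T R)) => //.
by move=> _ [_ [C mC [Z mZ <-] <-]]; rewrite !setTI -[X in measurable X]setTI; apply: mF.
Qed.

Lemma measurable_to_signed d' (T' : measurableType d')
    (F : T' -> signed_measure T R) :
  (forall B, measurable B -> measurable_fun setT (fun t => F t B)) ->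
  measurable_fun setT F.
Proof.
move=> mF; apply: (measurability (@signed_measure_evals _ T R)) => //.
by move=> _ [_ [C mC [Z mZ <-] <-]]; rewrite !setTI -[X in measurable X]setTI; apply: mF.
Qed.

(** Evaluations do not distinguish measures that agree on measurable sets, hence
neither does the sigma-algebra that they generate. *)
Lemma fin_saturated (B : set (fin_measure T R)) : measurable B ->
  forall m m' : fin_measure T R, agree m m' -> B m -> B m'.
Proof.
pose sat (B : set (fin_measure T R)) :=
  forall m m' : fin_measure T R, agree m m' -> B m -> B m'.
suff : measurable `<=` sat by apply.
apply: smallest_sub; first split.
- by [].
- move=> A satA m m' mm' [_ nA]; split=> // Am'; apply: nA; apply: satA Am'.
  by move=> C mC; rewrite mm'.
- by move=> F satF m m' mm' [n _ Fm]; exists n => //; exact: satF Fm.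
- move=> _ [C mC [Y mY <-]] m m' mm'; rewrite !setTI /=.
  by rewrite mm'.
Qed.

Lemma signed_saturated (B : set (signed_measure T R)) : measurable B ->
  forall m m' : signed_measure T R, agree m m' -> B m -> B m'.
Proof.
pose sat (B : set (signed_measure T R)) :=
  forall m m' : signed_measure T R, agree m m' -> B m -> B m'.
suff : measurable `<=` sat by apply.
apply: smallest_sub; first split.
- by [].
- move=> A satA m m' mm' [_ nA]; split=> // Am'; apply: nA; apply: satA Am'.
  by move=> C mC; rewrite mm'.
- by move=> F satF m m' mm' [n _ Fm]; exists n => //; exact: satF Fm.
- move=> _ [C mC [Y mY <-]] m m' mm'; rewrite !setTI /=.
  by rewrite mm'.
Qed.

End evaluations.

Section measurable_images.
Context d (T : measurableType d) (R : realType).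

Lemma measurable_finite_image d' (T' : measurableType d') (f : T -> T')
    (mf : measurable_fun setT f) :
  measurable_fun setT (fun mu : fin_measure T R => finite_image mu mf).
Proof.
apply: measurable_to_fin => B mB; apply: measurable_fin_eval.
by rewrite -[X in measurable X]setTI; exact: mf.
Qed.

Lemma measurable_tails d' (T' : measurableType d') (f : T -> R)
    (mu : T' -> fin_measure T R) o :
  measurable_fun setT f -> measurable_fun setT mu ->
  measurable_fun setT (fun t => tails f (mu t) o).
Proof.
move=> mf mmu; apply: measurableT_comp; first exact: fine_measurable.
apply: (@measurableT_comp _ _ _ _ _ _ (fun m : fin_measure T R => m (f @^-1` tail_set o))) => //.
apply: measurable_fin_eval.
rewrite -[X in measurable X]setTI; apply: mf => //.
by case: o => [q|] //=; exact: measurable_itv.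
Qed.

End measurable_images.

Section measure_decoding.
Context d (T : measurableType d) (R : realType).
Variables (f : T -> R) (g : R -> T).
Hypothesis fg : real_retract f g.

Let mf : measurable_fun setT f. Proof. by case: fg. Qed.
Let mg : measurable_fun setT g. Proof. by case: fg. Qed.
Let gK : cancel f g. Proof. by case: fg. Qed.

Lemma measurable_quantile_point (x : option rat -> R) :
  measurable_fun setT (fun u : unit_itv R => g (quantile x (val u))).
Proof.
apply: (measurableT_comp mg).
by apply: (@measurable_quantile _ _ _ (fun=> x)) => //; exact: measurable_unit_val.
Qed.

(** Every sequence of reals decodes to a finite measure: the absolute value of the
coefficient makes the formula meaningful without conditions on [x]. *)
Definition decode_measure (x : option rat -> R) : fin_measure T R :=
  mscale (`|x None|%:nng)%R
    (finite_image (leb01 : fin_measure _ R) (measurable_quantile_point x)).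

Lemma decode_measureE x A : decode_measure x A =
  (`|x None|%R)%:E * leb01 [set u : unit_itv R | A (g (quantile x (val u)))].
Proof. by []. Qed.

Lemma quantile_tails (mu : fin_measure T R) A : measurable A ->
  (tails f mu None)%:E *
    leb01 [set u : unit_itv R | A (g (quantile (tails f mu) (val u)))] = mu A.
Proof.
move=> mA; have [_ _ _ f01] := fg.
pose mu' := finite_image mu mf.
have mu'01 : mu' (~` `[0%R, 1%R]) = 0.
  rewrite /mu' finite_imageE (_ : _ @^-1` _ = set0) ?measure0//.
  by apply/seteqP; split => // t /=; apply; rewrite in_itv/=; exact: f01.
have mgA : measurable (g @^-1` A) by rewrite -[X in measurable X]setTI; exact: mg.
have := quantile_law mu'01 mgA.
rewrite [RHS](_ : _ = mu A)//.
by rewrite /mu' finite_imageE -comp_preimage; congr (mu _);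
  apply/seteqP; split => t /=; rewrite gK.
Qed.

(** Since [f] has values in the unit interval, [quantile_law] applies to the image
under [f], and [g] transports it back. *)
Lemma decode_measureK (mu : fin_measure T R) :
  agree (decode_measure (tails f mu)) mu.
Proof.
move=> A mA; rewrite decode_measureE -[RHS]quantile_tails// ger0_norm//.
by rewrite /tails fine_ge0.
Qed.

(** The value on A is the Lebesgue measure of a section of a measurable subset of
the product of the parameter space with the unit interval. *)
Lemma measurable_decode_measure d' (T' : measurableType d')
    (x : T' -> option rat -> R) :
  (forall o, measurable_fun setT (x ^~ o)) ->
  measurable_fun setT (fun t => decode_measure (x t)).
Proof.
move=> mx; apply: measurable_to_fin => A mA.
rewrite (_ : (fun _ => _) = (fun t => (`|x t None|%R)%:E *
  leb01 (xsection [set p : T' * unit_itv R | A (g (quantile (x p.1) (val p.2)))] t))).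
  apply: emeasurable_funM.
    by apply/measurable_EFinP; exact: measurableT_comp.
  apply: (@measurable_fun_xsection _ _ _ _ _ leb01).
  rewrite -[X in measurable X]setTI.
  apply: (_ : measurable_fun setT (fun p : T' * unit_itv R => g (quantile (x p.1) (val p.2)))) => //.
  apply: (measurableT_comp mg); apply: (@measurable_quantile _ _ _ (fun p => x p.1)).
    by move=> o; exact: (measurableT_comp (mx o)).
  by apply: measurableT_comp => //; exact: measurable_unit_val.
by apply/funext => t; rewrite decode_measureE xsectionE.
Qed.

End measure_decoding.

Section charge_difference.
Context d (T : measurableType d) (R : realType).
Implicit Types a b : fin_measure T R.

Definition charge_sub a b : signed_measure T R :=
  cadd (charge_of_finite_measure a) (copp (charge_of_finite_measure b)).

Lemma charge_subE a b A : charge_sub a b A = a A - b A.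
Proof. by []. Qed.

Definition charge_add a (nu : signed_measure T R) : signed_measure T R :=
  cadd (charge_of_finite_measure a) nu.

Lemma charge_addE a nu A : charge_add a nu A = a A + nu A.
Proof. by []. Qed.

End charge_difference.

(** * A countable family of sets that is dense for every finite measure *)

Section dense_families.
Context d (T : measurableType d) (R : realType).

Definition symdiff (A B : set T) := (A `\` B) `|` (B `\` A).

(** Density for the pseudometric [m (symdiff A B)], simultaneously for all finite
measures m. *)
Definition dense_family (C : nat -> set T) :=
  (forall n, measurable (C n)) /\
  forall (m : fin_measure T R) H e, measurable H -> (0 < e)%R ->
    exists n, m (symdiff H (C n)) < e%:E.

Section closure.
Variable E : nat -> set T.
Hypothesis mE : forall n, measurable (E n).

(** The algebra generated by [E], built in stages so that it comes with an
enumeration: each stage consists of the unions of two sets and the complements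
of the sets of the preceding one. *)
Fixpoint level (k : nat) : nat -> set T :=
  if k is k'.+1 then fun n =>
    if @unpickle (nat * nat * bool)%type n is Some (i, j, b) then
      if b then level k' i `|` level k' j else ~` level k' i
    else set0
  else E.

Lemma measurable_level k n : measurable (level k n).
Proof.
elim: k n => [|k IH] n //=; case: unpickle => [[[i j] []]|] //.
- exact: measurableU.
- exact: measurableC.
Qed.

Lemma levelU k i j : exists n, level k.+1 n = level k i `|` level k j.
Proof. by exists (pickle (i, j, true)); rewrite /= pickleK. Qed.

Lemma levelC k i : exists n, level k.+1 n = ~` level k i.
Proof. by exists (pickle (i, i, false)); rewrite /= pickleK. Qed.

(** Each set reappears in the next stage as its union with itself. *)
Lemma level_mono k l i : exists n, level (l + k) n = level k i.
Proof.
elim: l => [|l [n IH]]; first by exists i.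
by have [p] := levelU (l + k) n n; rewrite setUid IH => <-; exists p.
Qed.

Variable m : fin_measure T R.

Definition approximable : set (set T) := [set H | measurable H /\
  forall e : R, (0 < e)%R -> exists k n, m (symdiff H (level k n)) < e%:E].

Let measurable_symdiff A B : measurable A -> measurable B ->
  measurable (symdiff A B).
Proof. by move=> mA mB; apply: measurableU; apply: measurableD. Qed.

Let le_m A B : measurable A -> measurable B -> A `<=` B -> m A <= m B.
Proof. by move=> mA mB; apply: le_measure; rewrite inE. Qed.

Let symdiff_cover A B1 B2 e1 e2 : measurable A -> measurable B1 ->
  measurable B2 -> A `<=` B1 `|` B2 -> m B1 < e1%:E -> m B2 < e2%:E ->
  m A < (e1 + e2)%:E.
Proof.
move=> mA mB1 mB2 AB h1 h2; apply: (@le_lt_trans _ _ (m B1 + m B2)).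
  apply: (@le_trans _ _ (m (B1 `|` B2))); last exact: measureU2.
  by apply: le_m => //; exact: measurableU.
by rewrite EFinD; exact: lteD.
Qed.

Lemma approximable_level k n : approximable (level k n).
Proof.
split; first exact: measurable_level.
move=> e e0; exists k, n.
by rewrite /symdiff setDv setU0 measure0 lte_fin.
Qed.

Lemma approximableC A : approximable A -> approximable (~` A).
Proof.
move=> [mA aA]; split=> [|e /aA[k [i Ai]]]; first exact: measurableC.
have [n nE] := levelC k i; exists k.+1, n; rewrite nE.
by rewrite /symdiff !setDE !setCK setUC [_ `&` A]setIC [~` A `&` _]setIC.
Qed.

(** The two approximating sets must first be brought to a common stage. *)
Lemma approximableU A B : approximable A -> approximable B ->
  approximable (A `|` B).
Proof.
move=> [mA aA] [mB aB]; split=> [|e e0]; first exact: measurableU.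
have e20 : (0 < e / 2)%R by rewrite divr_gt0.
have [k [i Ai]] := aA _ e20; have [l [j Bj]] := aB _ e20.
(* Stage [l + k] contains both approximating sets. *)
have [i' i'E] := level_mono k l i; have [j' j'E] := level_mono l k j.
have [n nE] := levelU (l + k) i' j'; exists (l + k).+1, n.
rewrite nE i'E addnC j'E [e]splitr.
apply: (symdiff_cover _ _ _ _ Ai Bj).
- by apply: measurable_symdiff; apply: measurableU => //; exact: measurable_level.
- by apply: measurable_symdiff => //; exact: measurable_level.
- by apply: measurable_symdiff => //; exact: measurable_level.
- by move=> t [[[At|Bt] /not_orP[nC nD]]|[[Ct|Dt] /not_orP[nA nB]]];
    [left; left|right; left|left; right|right; right].
Qed.

(** A countable union is approximated by its finite partial unions, because m is
finite, and these by the algebra. *)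
Lemma approximable_sigma_algebra : sigma_algebra setT approximable.
Proof.
have a0 : approximable set0.
  have a := approximable_level 0 0.
  have := approximableC (approximableU a (approximableC a)).
  by rewrite setUv setCT.
split => [//|A|F aF].
  by rewrite setTD; exact: approximableC.
pose U n := \bigcup_(i < n) F i.
have mF i : measurable (F i) by have [] := aF i.
have mUF : measurable (\bigcup_i F i) by exact: bigcupT_measurable.
have aU n : approximable (U n).
  rewrite /U; elim: n => [|n IH]; first by rewrite bigcup_mkord big_ord0.
  by rewrite bigcup_mkord big_ord_recr/= -bigcup_mkord; exact: approximableU.
split => // e e0; have e20 : (0 < e / 2)%R by rewrite divr_gt0.
have cU : m (\bigcup_i F i `\` U n) @[n --> \oo] --> 0.
  rewrite -(@measure0 _ _ _ m).
  rewrite (_ : set0 = \bigcap_n (\bigcup_i F i `\` U n)).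
    apply: nonincreasing_cvg_mu => //.
    - rewrite -ge0_fin_numE//; apply: fin_num_measure.
      by apply: measurableD => //; case: (aU 0%N).
    - move=> n; apply: measurableD => //; by case: (aU n).
    - apply: bigcapT_measurable => n; apply: measurableD => //; by case: (aU n).
    - move=> i j ij; apply/subsetPset => t [Ft nU]; split => // -[k /= ki Fk].
      by apply: nU; exists k => //=; exact: leq_trans ij.
  apply/seteqP; split => // t /= tF; have [[i _ Fi] _] := tF 0%N I.
  by have [_] := tF i.+1 I; apply; exists i => /=.
have [n Un] : exists n, m (\bigcup_i F i `\` U n) < (e / 2)%:E.
  apply: contrapT => /forallNP noU; have : (e / 2)%:E <= 0.
    rewrite -(cvg_lim _ cU)//; apply: lime_ge.
      by apply/cvg_ex; eexists; exact: cU.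
    by apply: nearW => n; rewrite leNgt; apply/negP; exact: noU.
  by rewrite leNgt lte_fin e20.
have [_ /(_ _ e20)[k [i Ui]]] := aU n; exists k, i.
rewrite [e]splitr; apply: (symdiff_cover _ _ _ _ Un Ui).
- by apply: measurable_symdiff => //; exact: measurable_level.
- by apply: measurableD => //; case: (aU n).
- by apply: measurable_symdiff; [case: (aU n)|exact: measurable_level].
- move=> t [[Ft nC]|[Ct nF]].
    by have [Ut|nU] := pselect (U n t); [right; left|left].
  by right; right; split => // -[j _ Fj]; apply: nF; exists j.
Qed.

End closure.

(** The preimages under [f] of the rational half-lines generate an algebra whose
approximable sets form a sigma-algebra; this contains the preimages of the real
half-lines, hence of all Borel sets, and every measurable A is the preimage of
[g @^-1` A]. *)
Lemma borel_dense_family : borel_space T R -> exists C, dense_family C.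
Proof.
move=> /borel_space_retract[f [g [mf mg gK _]]].
pose E n : set T := if @unpickle rat n is Some q then f @^-1` `]ratr q, +oo[ else set0.
have mE n : measurable (E n).
  rewrite /E; case: unpickle => [q|//].
  by rewrite -[X in measurable X]setTI; apply: mf => //; exact: measurable_itv.
pose C p := if @unpickle (nat * nat)%type p is Some (k, n) then level E k n else set0.
exists C; split => [p|m H e mH e0].
  by rewrite /C; case: unpickle => [[k n]|//]; exact: measurable_level.
suff [_ /(_ _ e0)[k [n kn]]] : approximable E m H.
  by exists (pickle (k, n)); rewrite /C pickleK.
have [a0 aC aU] := approximable_sigma_algebra mE m.
have -> : H = f @^-1` (g @^-1` H) by apply/seteqP; split => t /=; rewrite gK.
have : measurable (g @^-1` H) by rewrite -[X in measurable X]setTI; exact: mg.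
move: (g @^-1` H); rewrite [measurable]RGenOInfty.measurableE.
suff : <<s @RGenOInfty.G R >> `<=` [set B | approximable E m (f @^-1` B)] by apply.
apply: smallest_sub.
  split => /= [|A|F aF]; first by rewrite preimage_set0.
    by move/aC; rewrite !setTD preimage_setC.
  by rewrite preimage_bigcup; exact: aU.
move=> _ [x ->] /=.
pose G n := if @unpickle rat n is Some q then
  if (x < ratr q)%R then f @^-1` `]ratr q, +oo[ else set0 else set0.
rewrite (_ : _ @^-1` _ = \bigcup_n G n).
  apply: aU => n; rewrite /G; case Eq : unpickle => [q|//]; case: ifPn => // _.
  by have := approximable_level mE m 0 n; rewrite /= {2}/E Eq.
apply/seteqP; split => t /=; rewrite in_itv/= andbT.
  move=> /rat_in_itvoo[q]; rewrite in_itv/= => /andP[xq qf].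
  exists (pickle q); first exact: I.
  by rewrite /G pickleK xq /= in_itv/= andbT.
move=> [n _]; rewrite /G; case: unpickle => [q|//]; case: ifPn => // xq /=.
by rewrite in_itv/= andbT; exact: lt_trans.
Qed.

End dense_families.

(** * Measurability of the Jordan decomposition *)

Section sum_of_finite_measures.
Context d (T : measurableType d) (R : realType).
Variables a b : fin_measure T R.

Let add : set T -> \bar R := measure_add a b.

HB.instance Definition _ := Measure.on add.

Let add_finite : fin_num_fun add.
Proof. by move=> A mA; rewrite /add measure_addE fin_numD !fin_num_measure. Qed.

HB.instance Definition _ := @Measure_isFinite.Build _ _ _ add add_finite.

Definition finite_add : fin_measure T R := add.

Lemma finite_addE A : finite_add A = a A + b A.
Proof. exact: measure_addE. Qed.

End sum_of_finite_measures.

Section jordan.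
Context d (T : measurableType d) (R : realType).
Implicit Types nu : signed_measure T R.

(** A Hahn decomposition chosen for each [nu] separately, with no regularity in [nu];
the Jordan parts are measurable in [nu] all the same, by [jpos_sup]. *)
Definition hahn_pos nu : set T := sval (cid (Hahn_decomposition nu)).
Definition hahn_neg nu : set T := sval (cid (svalP (cid (Hahn_decomposition nu)))).
Definition hahn_spec nu : hahn_decomposition nu (hahn_pos nu) (hahn_neg nu) :=
  svalP (cid (svalP (cid (Hahn_decomposition nu)))).

Definition jpos nu : fin_measure T R := jordan_pos (hahn_spec nu).
Definition jneg nu : fin_measure T R := jordan_neg (hahn_spec nu).

Let mP nu : measurable (hahn_pos nu).
Proof. by have [[]] := hahn_spec nu. Qed.

Let mN nu : measurable (hahn_neg nu).
Proof. by have [_ []] := hahn_spec nu. Qed.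

Lemma jposE nu A : measurable A -> jpos nu A = nu (A `&` hahn_pos nu).
Proof. by move=> mA; rewrite -[LHS]/(crestr0 nu (mP nu) A) /crestr0 mem_set. Qed.

Lemma jnegE nu A : measurable A -> jneg nu A = - nu (A `&` hahn_neg nu).
Proof. by move=> mA; rewrite -[LHS]/(cscale (-1) (crestr0 nu (mN nu)) A) cscaleN1 /= /crestr0 mem_set. Qed.

Lemma jordanE nu A : measurable A -> nu A = jpos nu A - jneg nu A.
Proof.
move=> mA; rewrite {1}(jordan_decomp (hahn_spec nu) mA) /cadd /=.
by rewrite cscaleN1.
Qed.

Lemma jnegB nu A : measurable A -> jneg nu A = jpos nu A - nu A.
Proof.
move=> mA; rewrite (jordanE _ mA).
have : jpos nu A \is a fin_num by exact: fin_num_measure.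
have : jneg nu A \is a fin_num by exact: fin_num_measure.
move: (jneg nu A) (jpos nu A) => [a||] [b||] //= _ _.
by rewrite -!EFinB opprB addrC subrK.
Qed.

Section dense.
Variable C : nat -> set T.
Hypothesis dC : dense_family R C.

(** The value of the positive part on A is that of [nu] on [A `&` P], P the positive
set, and no [nu (A `&` B)] is larger.  Replacing P by a member C n of the dense
family changes the value by at most the mass of the symmetric difference under
the sum of the positive and the negative part. *)
Lemma jpos_sup nu A : measurable A ->
  jpos nu A = ereal_sup (range (fun n => nu (A `&` C n))).
Proof.
move=> mA; have [mC dense] := dC.
apply/eqP; rewrite eq_le; apply/andP; split; last first.
  apply: ge_ereal_sup => _ [n _ <-].
  have mAC : measurable (A `&` C n) by exact: measurableI.
  rewrite jordanE//; apply: (@le_trans _ _ (jpos nu (A `&` C n))).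
    by rewrite leeBlDr ?leeDl// fin_num_measure.
  by rewrite le_measure ?inE.
apply/lee_addgt0Pr => e e0.
(* The total variation of [nu] controls both errors below. *)
pose m : fin_measure T R := finite_add (jpos nu) (jneg nu).
have e20 : (0 < e / 2)%R by rewrite divr_gt0.
have [n mn] := dense m _ _ (mP nu) e20.
have mS : measurable (symdiff (hahn_pos nu) (C n)).
  by apply: measurableU; apply: measurableD.
have mAC : measurable (A `&` C n) by exact: measurableI.
have mAD : measurable (A `\` C n) by exact: measurableD.
have le_mu (mu : fin_measure T R) X Y :
    measurable X -> measurable Y -> X `<=` Y -> mu X <= mu Y.
  by move=> mX mY; apply: le_measure; rewrite inE.
have pos_small : jpos nu (A `\` C n) <= (e / 2)%:E.
  apply: le_trans (ltW mn); rewrite finite_addE.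
  apply: (@le_trans _ _ (jpos nu (symdiff (hahn_pos nu) (C n)))); last first.
    by rewrite leeDl.
  have -> : jpos nu (A `\` C n) = jpos nu ((A `\` C n) `&` hahn_pos nu).
    by rewrite !jposE//; [rewrite -[in RHS]setIA setIid|exact: measurableI].
  apply: le_mu => //; first exact: measurableI.
  by move=> t [[_ nC] Pt]; left.
have neg_small : jneg nu (A `&` C n) <= (e / 2)%:E.
  apply: le_trans (ltW mn); rewrite finite_addE.
  apply: (@le_trans _ _ (jneg nu (symdiff (hahn_pos nu) (C n)))); last first.
    by rewrite leeDr.
  have -> : jneg nu (A `&` C n) = jneg nu ((A `&` C n) `&` hahn_neg nu).
    by rewrite !jnegE//; [rewrite -[in RHS](setIA (A `&` _)) setIid|exact: measurableI].
  apply: le_mu => //; first exact: measurableI.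
  have [_ _ _ PN0] := hahn_spec nu.
  move=> t [[_ Ct] Nt]; right; split => // Pt.
  by have : (hahn_pos nu `&` hahn_neg nu) t by []; rewrite PN0.
apply: (@le_trans _ _ (nu (A `&` C n) + e%:E)); last first.
  by apply: leeD => //; apply: ereal_sup_ubound; exists n.
have -> : jpos nu A = jpos nu (A `&` C n) + jpos nu (A `\` C n).
  by rewrite addeC; exact: measureDI.
rewrite (jordanE _ mAC).
have /fineK : jpos nu (A `&` C n) \is a fin_num by exact: fin_num_measure.
have /fineK : jneg nu (A `&` C n) \is a fin_num by exact: fin_num_measure.
have /fineK : jpos nu (A `\` C n) \is a fin_num by exact: fin_num_measure.
move=> p1 p2 p3; move: pos_small neg_small; rewrite -p1 -p2 -p3.
by rewrite -EFinB -!EFinD !lee_fin; lra.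
Qed.

(** The point of [jpos_sup]: the family [C] is countable and is the same for all
[nu], unlike the positive sets. *)
Lemma measurable_jpos : measurable_fun setT jpos.
Proof.
apply: measurable_to_fin => A mA; have [mC _] := dC.
apply: (eq_measurable_fun (fun nu => ereal_sup (range (fun n => nu (A `&` C n))))).
  by move=> nu _; rewrite jpos_sup.
apply: (@measurable_countable_sup _ _ _ _ (fun n (nu : signed_measure T R) => nu (A `&` C n))) => n.
by apply: measurable_signed_eval; exact: measurableI.
Qed.

Lemma measurable_jneg : measurable_fun setT jneg.
Proof.
apply: measurable_to_fin => A mA.
apply: (eq_measurable_fun (fun nu => jpos nu A - nu A)).
  by move=> nu _; rewrite jnegB.
apply: emeasurable_funB; last exact: measurable_signed_eval.
apply: (@measurableT_comp _ _ _ _ _ _ (fun m : fin_measure T R => m A)).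
  exact: measurable_fin_eval.
exact: measurable_jpos.
Qed.

End dense.
End jordan.

(** * The product with Lebesgue measure and its inverse *)

Section lift.
Context d (T : measurableType d) (R : realType).
Implicit Types mu : fin_measure T R.

Section def.
Variable mu : fin_measure T R.

Let prod : set (T * unit_itv R) -> \bar R := mu \x leb01.

HB.instance Definition _ := Measure.on prod.

Let prod_finite : fin_num_fun prod.
Proof.
apply: lty_fin_num_fun.
rewrite -setXTT [X in X < _]product_measure1E// -ge0_fin_numE ?mule_ge0//.
by rewrite fin_numM// fin_num_measure.
Qed.

HB.instance Definition _ := @Measure_isFinite.Build _ _ _ prod prod_finite.

Definition lift_measure : fin_measure (T * unit_itv R)%type R := prod.

End def.

Lemma lift_measureE mu A : lift_measure mu A = (mu \x leb01) A.
Proof. by []. Qed.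

Lemma lift_rect mu A : measurable A -> lift_measure mu (A `*` setT) = mu A.
Proof.
move=> mA; rewrite lift_measureE [LHS]product_measure1E//.
by rewrite [X in _ * X]probability_setT mule1.
Qed.

Lemma eq_lift_measure mu mu' :
  agree mu mu' -> agree (lift_measure mu) (lift_measure mu').
Proof.
move=> mumu' A mA; rewrite !lift_measureE; apply: eq_measure_integral.
by move=> B mB _; exact: mumu'.
Qed.

(** Additivity in the first factor, used to extend the product with Lebesgue measure
to differences of measures. *)
Lemma lift_measure_add mu mu' A : measurable A ->
  lift_measure (finite_add mu mu') A = lift_measure mu A + lift_measure mu' A.
Proof.
move=> mA; transitivity (\int[measure_add mu mu']_s leb01 (xsection A s)).
  by apply: eq_measure_integral => B mB _.
rewrite ge0_integral_measure_add//.
exact: (@measurable_fun_xsection _ _ _ _ _ leb01).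
Qed.

Lemma measurable_lift_measure : measurable_fun setT lift_measure.
Proof.
apply: measurable_to_fin => B mB.
apply: (@measurable_fun_integral_kernel _ _ (fin_measure T R) T R
  (fun mu => mu) _ (fun s => leb01 (xsection B s))) => //.
- by move=> U mU; exact: measurable_fin_eval.
- exact: (@measurable_fun_xsection _ _ _ _ _ leb01).
Qed.

Definition project_measure (m : fin_measure (T * unit_itv R)%type R) :
  fin_measure T R := finite_image m measurable_fst.

Lemma project_measureE m A : measurable A ->
  project_measure m A = m (A `*` setT).
Proof.
move=> mA; rewrite /project_measure finite_imageE; congr (m _).
by apply/seteqP; split => -[s u] //= [].
Qed.

Lemma lift_measureK mu : agree (project_measure (lift_measure mu)) mu.
Proof. by move=> A mA; rewrite project_measureE// lift_rect. Qed.

Lemma eq_project_measure (m m' : fin_measure (T * unit_itv R)%type R) :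
  agree m m' -> agree (project_measure m) (project_measure m').
Proof.
by move=> mm' A mA; rewrite !project_measureE// mm'//; exact: measurableX.
Qed.

End lift.

Section determining_family.
Context d (T : measurableType d) (R : realType).
Hypothesis bT : borel_space T R.

(** A measure is decoded from its countably many tails, and so determined by them. *)
Lemma countable_determining_family : exists C : nat -> set T,
  (forall n, measurable (C n)) /\
  forall m m' : fin_measure T R, (forall n, m (C n) = m' (C n)) -> agree m m'.
Proof.
have [f [g fg]] := borel_space_retract bT; have [mf _ _ _] := fg.
pose C n : set T := f @^-1` tail_set (odflt None (unpickle n)).
exists C; split => [n|m m' mm' A mA].
  rewrite -[X in measurable X]setTI; apply: mf => //.
  by case: (odflt _ _) => [q|] //=; exact: measurable_itv.
have tails_eq : tails f m = tails f m'.
  apply/funext => o; rewrite /tails.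
  by have := mm' (pickle o); rewrite /C pickleK /= => ->.
by rewrite -(decode_measureK fg m)// tails_eq decode_measureK.
Qed.

End determining_family.

(** * Randomisation of kernels into the space of signed measures *)

Lemma measurable_charge_sub d (T : measurableType d) (R : realType)
    d' (T' : measurableType d') (a b : T' -> fin_measure T R) :
  measurable_fun setT a -> measurable_fun setT b ->
  measurable_fun setT (fun t => charge_sub (a t) (b t)).
Proof.
move=> ma mb; apply: measurable_to_signed => A mA.
have meval := measurable_fin_eval (R := R) mA.
apply: (eq_measurable_fun (fun t => a t A - b t A)) => //.
by apply: emeasurable_funB; [exact: (measurableT_comp meval ma)|
                             exact: (measurableT_comp meval mb)].
Qed.

Section randomisation.
Context d (T : measurableType d) (R : realType).
Variables (f : T -> R) (g : R -> T) (C : nat -> set T).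
Hypothesis fg : real_retract f g.
Hypothesis dC : dense_family R C.

Let mf : measurable_fun setT f. Proof. by case: fg. Qed.

(** The tails of both Jordan parts, coded by one real in the unit interval. *)
Definition jordan_code (nu : signed_measure T R) : R :=
  encode (fun p : bool * option rat =>
    tails f (if p.1 then jpos nu else jneg nu) p.2).

Definition decode_part (b : bool) (y : R) : fin_measure T R :=
  decode_measure fg (fun o => decode y (b, o)).

(** Defined on the whole line: every real codes some signed measure, so that the
randomisation never leaves the space of signed measures. *)
Definition decode_signed (y : R) : signed_measure T R :=
  charge_sub (decode_part true y) (decode_part false y).

Lemma measurable_jordan_code : measurable_fun setT jordan_code.
Proof.
apply: (@measurable_encode _ _ _ _ (fun nu (p : bool * option rat) =>
  tails f (if p.1 then jpos nu else jneg nu) p.2)) => -[[] o] /=.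
- exact: measurable_tails (measurable_jpos dC).
- exact: measurable_tails (measurable_jneg dC).
Qed.

Lemma measurable_decode_part b : measurable_fun setT (decode_part b).
Proof. by apply: measurable_decode_measure => o; exact: measurable_decode. Qed.

Lemma measurable_decode_signed : measurable_fun setT decode_signed.
Proof. by apply: measurable_charge_sub; exact: measurable_decode_part. Qed.

Lemma jordan_codeK nu : agree (decode_signed (jordan_code nu)) nu.
Proof.
move=> A mA; rewrite /decode_signed charge_subE /decode_part /jordan_code encodeK.
by rewrite !decode_measureK// -jordanE.
Qed.

Section kernel.
Context d' (S : measurableType d').
Variable K : R.-pker S ~> signed_measure T R.

(** The quantile function of the law of [jordan_code] under [K s]. *)
Definition random_code (p : S * unit_itv R) : R :=
  quantile (tails jordan_code (K p.1)) (val p.2).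

Lemma measurable_random_code : measurable_fun setT random_code.
Proof.
apply: (@measurable_quantile _ _ _ (fun p : S * unit_itv R => tails jordan_code (K p.1))).
  move=> o; apply: measurableT_comp; first exact: fine_measurable.
  apply: (@measurableT_comp _ _ _ _ _ _ (fun s => K s (jordan_code @^-1` tail_set o))) => //.
  apply: measurable_kernel.
  rewrite -[X in measurable X]setTI; apply: measurable_jordan_code => //.
  by case: o => [q|] //=; exact: measurable_itv.
by apply: measurableT_comp => //; exact: measurable_unit_val.
Qed.

(** By [quantile_law] the code has under Lebesgue measure the law of [jordan_code]
under [K s]; decoding gives back [K s], because [jordan_codeK] holds up to
agreement and measurable sets do not see the difference. *)
Lemma random_code_law s A : measurable A ->
  leb01 [set u | A (decode_signed (random_code (s, u)))] = K s A.
Proof.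
move=> mA.
(* Normalising changes nothing, but packages [K s] as a finite measure. *)
pose Ks : fin_measure (signed_measure T R) R := mnormalize (K s) point.
have KsE B : Ks B = K s B.
  rewrite /Ks /= /mnormalize prob_kernel onee_eq0 /=.
  by rewrite invr1 mule1.
pose mu := finite_image Ks measurable_jordan_code.
have mu01 : mu (~` `[0%R, 1%R]) = 0.
  rewrite /mu finite_imageE (_ : _ @^-1` _ = set0) ?measure0//.
  by apply/seteqP; split => // nu /=; apply; rewrite in_itv/=; exact: encode_itv.
have mB : measurable (decode_signed @^-1` A).
  by rewrite -[X in measurable X]setTI; exact: measurable_decode_signed.
have := quantile_law mu01 mB.
have -> : mu (decode_signed @^-1` A) = K s A.
  rewrite /mu finite_imageE KsE -comp_preimage; congr (K s _).
  apply/seteqP; split => nu /=; apply: signed_saturated => //.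
    exact: jordan_codeK.
  by move=> B mB'; rewrite jordan_codeK.
have tailsE : tails id mu = tails jordan_code (K s).
  by apply/funext => o; rewrite /tails /mu finite_imageE KsE.
have -> : (tails id mu None)%:E = 1.
  by rewrite tailsE /tails preimage_setT prob_kernel.
by rewrite mul1e tailsE.
Qed.

End kernel.

(** The sum [mu + nu] is a finite measure exactly when its negative part vanishes,
and it is then its own positive part. *)
Lemma shift_inE (B : set (fin_measure T R)) (mu : fin_measure T R) :
  measurable B -> shift_in B mu =
  [set nu | jneg (charge_add mu nu) setT = 0 /\ B (jpos (charge_add mu nu))].
Proof.
move=> mB; apply/seteqP; split => nu /=.
  move=> [m Bm mE].
  have neg0 A : measurable A -> jneg (charge_add mu nu) A = 0.
    move=> mA; apply/eqP; rewrite eq_le measure_ge0 andbT jnegE// charge_addE.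
    have mAN : measurable (A `&` hahn_neg (charge_add mu nu)).
      by apply: measurableI => //; have [_ []] := hahn_spec (charge_add mu nu).
    by rewrite -(mE _ mAN) oppe_le0.
  split; first exact: neg0.
  apply: fin_saturated Bm => // A mA.
  by have := jordanE (charge_add mu nu) mA; rewrite neg0// sube0 charge_addE mE.
move=> [neg0 Bp]; exists (jpos (charge_add mu nu)) => // A mA.
have negA : jneg (charge_add mu nu) A = 0.
  by apply: (@subset_measure0 _ _ _ _ A setT).
by have := jordanE (charge_add mu nu) mA; rewrite negA sube0 charge_addE.
Qed.

Lemma measurable_shift_in (B : set (fin_measure T R)) (mu : fin_measure T R) :
  measurable B -> measurable (shift_in B mu).
Proof.
move=> mB; rewrite shift_inE//.
have madd : measurable_fun setT (charge_add mu).
  apply: measurable_to_signed => A mA.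
  by apply: emeasurable_funD => //; exact: measurable_signed_eval.
have mneg : measurable_fun setT (fun nu => jneg (charge_add mu nu) setT).
  apply: (measurableT_comp (measurable_fin_eval measurableT)).
  exact: (measurableT_comp (measurable_jneg dC) madd).
have mpos : measurable_fun setT (fun nu => jpos (charge_add mu nu)).
  exact: (measurableT_comp (measurable_jpos dC) madd).
have m0 := mneg measurableT [set 0] (emeasurable_set1 0).
by have := measurableI _ _ m0 (mpos measurableT _ mB); rewrite !setTI.
Qed.

End randomisation.

(** * The lifted urn *)

(** Rearranges an equation between measures so that no subtraction remains. *)
Lemma fin_num_balance (R : realType) (x y z w : \bar R) :
  x \is a fin_num -> y \is a fin_num -> z \is a fin_num -> w \is a fin_num ->
  x = y + (z - w) <-> x + w = y + z.
Proof.
move: x y z w => [x||] [y||] [z||] [w||] //= _ _ _ _.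
rewrite -EFinB -!EFinD; split=> -[h]; congr EFin.
  by rewrite h addrA subrK.
by rewrite addrA -h addrK.
Qed.

Lemma measure_setC_full d (T : measurableType d) (R : realType)
    (m : {measure set T -> \bar R}) A :
  measurable A -> m setT = 1 -> m A = 1 -> m (~` A) = 0.
Proof.
move=> mA mT mA1; have : m setT = m A + m (~` A).
  rewrite -(setUv A); apply: measureU => //; first exact: measurableC.
  exact: setICr.
rewrite mT mA1; case: (m _) => [r||] //; rewrite -EFinD => -[r1].
by congr EFin; apply: (addrI 1%R); rewrite -r1 addr0.
Qed.

Section lifted_state_sets.
Context d (T : measurableType d) (R : realType).
Local Notation M := (fin_measure T R).
Local Notation Mt := (fin_measure (T * unit_itv R)%type R).
Implicit Types (B : set M) (mu a b : M) (mt : Mt).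

(** The only possible preimage of a lifted state is its projection. *)
Lemma lifted_states_project (N0 : set M) mt : measurable N0 ->
  lifted_states N0 mt <->
  N0 (project_measure mt) /\ agree mt (lift_measure (project_measure mt)).
Proof.
move=> mN0; split=> [[mu N0mu mtE]|[N0p mtE]]; last by exists (project_measure mt).
have pE : agree (project_measure mt) mu.
  by move=> A mA; rewrite (eq_project_measure (m' := lift_measure mu))// lift_measureK.
split; first by apply: (fin_saturated mN0 _ N0mu) => A mA; rewrite pE.
by move=> A mA; rewrite mtE// (eq_lift_measure pE).
Qed.

(** The condition that a measure is the lift of its projection involves only
countably many values, by [countable_determining_family] on the product space. *)
Lemma measurable_lifted_states (N0 : set M) : borel_space T R -> measurable N0 ->
  measurable (lifted_states N0).
Proof.
move=> bT mN0.
have [C [mC agreeC]] :=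
  countable_determining_family (borel_space_prod bT (borel_space_unit_itv R)).
have mp : measurable_fun setT (@project_measure _ T R).
  exact: measurable_finite_image.
have mlp := measurableT_comp (@measurable_lift_measure _ T R) mp.
rewrite (_ : lifted_states N0 = (@project_measure _ T R) @^-1` N0 `&`
  \bigcap_n [set mt : Mt | mt (C n) = lift_measure (project_measure mt) (C n)]).
  apply: measurableI; first by rewrite -[X in measurable X]setTI; exact: mp.
  apply: bigcapT_measurable => n; rewrite -[X in measurable X]setTI.
  apply: (@measurable_eqe _ _ _ _ measurableT (fun mt : Mt => mt (C n))).
    exact: measurable_fin_eval.
  exact: (measurableT_comp (measurable_fin_eval (mC n)) mlp).
apply/seteqP; split => mt.
  by move=> /(lifted_states_project _ mN0)[N0p mtE]; split => // n _; exact: mtE.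
move=> [N0p mtC]; apply/(lifted_states_project _ mN0); split => //.
by apply: agreeC => n; exact: mtC.
Qed.

Lemma lifted_states_preimage (N0 : set M) (Bt : set Mt) : measurable Bt ->
  Bt `<=` lifted_states N0 ->
  Bt = lifted_states (@lift_measure _ T R @^-1` Bt).
Proof.
move=> mBt BtN0; apply/seteqP; split => mt.
  move=> Bmt; have [mu _ mtE] := BtN0 _ Bmt; exists mu => //=.
  exact: (fin_saturated mBt (m' := lift_measure mu) mtE).
by move=> [mu /= Bmu mtE]; apply: (fin_saturated mBt _ Bmu) => A mA; rewrite mtE.
Qed.

(** Lifting commutes with adding a replacement.  In one direction the equation of
measures is evaluated on the cylinders [A `*` setT]; in the other it is put in
the form of an equality of sums of finite measures, which lifts. *)
Lemma shift_in_lift B mu mt a b : agree mt (lift_measure mu) ->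
  shift_in (lifted_states B) mt (charge_sub (lift_measure a) (lift_measure b)) <->
  shift_in B mu (charge_sub a b).
Proof.
move=> mtE.
have fin (m : M) A : measurable A -> m A \is a fin_num.
  by move=> mA; exact: fin_num_measure.
have fint (m : Mt) A : measurable A -> m A \is a fin_num.
  by move=> mA; exact: fin_num_measure.
split=> [[m' [m Bm m'E] mtm']|[m Bm mE]].
  exists m => // A mA; have mAT : measurable (A `*` [set: unit_itv R]).
    exact: measurableX.
  have := mtm' _ mAT; rewrite m'E// -lift_measureE /= !charge_subE.
  by rewrite (mtE _ mAT) !lift_rect.
exists (lift_measure m); first by exists m.
move=> A mA.
transitivity (lift_measure mu A + (lift_measure a A - lift_measure b A)); last first.
  by congr (_ + _); exact/esym/mtE.
have sumE : agree (finite_add m b) (finite_add mu a).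
  move=> D mD; rewrite !finite_addE.
  by apply/fin_num_balance; rewrite ?fin//; have := mE D mD.
have := eq_lift_measure sumE mA.
rewrite (lift_measure_add m b mA) (lift_measure_add mu a mA).
move=> h.
apply/(fin_num_balance (fint _ _ mA) (fint _ _ mA) (fint _ _ mA) (fint _ _ mA)).
exact: h.
Qed.

Lemma nonzero_mass mu : nonzero_measures mu -> mu setT != 0.
Proof.
move=> mu0; apply/eqP => muT; apply: mu0 => A mA.
exact: (@subset_measure0 _ _ _ _ A setT).
Qed.

End lifted_state_sets.

Section urn.
Context d (S : measurableType d) (R : realType).
Variables (f : S -> R) (g : R -> S) (C : nat -> set S).
Hypothesis fg : real_retract f g.
Hypothesis dC : dense_family R C.
Variable Rk : R.-pker S ~> signed_measure S R.

(** The replacement before it is multiplied by Lebesgue measure: for fixed first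
coordinate its law is the kernel. *)
Definition random_signed (p : S * unit_itv R) : signed_measure S R :=
  decode_signed fg (random_code f Rk p).

Definition lifted_replacement (p : S * unit_itv R) :
    signed_measure (S * unit_itv R)%type R :=
  charge_sub (lift_measure (decode_part fg true (random_code f Rk p)))
             (lift_measure (decode_part fg false (random_code f Rk p))).

Lemma measurable_lifted_replacement : measurable_fun setT lifted_replacement.
Proof.
have mlift := @measurable_lift_measure _ S R.
have mdec b := @measurable_decode_part _ _ _ _ _ fg b.
have mcode := measurable_random_code fg dC Rk.
by apply: measurable_charge_sub; apply: (measurableT_comp mlift);
  apply: (measurableT_comp (mdec _) mcode).
Qed.

Let W A := [set p | A (random_signed p)].

Lemma measurable_random_signed A : measurable A -> measurable (W A).
Proof.
move=> mA; rewrite -[X in measurable X]setTI.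
have mdec := measurable_decode_signed fg.
exact: (measurableT_comp mdec (measurable_random_code fg dC Rk)).
Qed.

(** The product measure integrates the measures of the sections, and these are given
by [random_code_law]. *)
Lemma lift_random_signed (mu : fin_measure S R) A : measurable A ->
  lift_measure mu (W A) = \int[mu]_s Rk s A.
Proof.
move=> mA; rewrite lift_measureE; apply: eq_integral => s _ /=.
by rewrite -(random_code_law fg dC Rk s mA) xsectionE.
Qed.

Variable M0 : set (fin_measure S R).
Hypothesis mM0 : measurable M0.
Hypothesis M0_nonzero : M0 `<=` nonzero_measures (T := S) (R := R).

(** The exceptional set is the set of the (s, u) whose unlifted replacement is not
admissible; its measure is the integral of [Rk s (~` shift_in M0 mu)], which
vanishes almost everywhere. *)
Lemma lifted_replacement_admissible :
  (forall mu, M0 mu -> {ae mu, forall s, Rk s (shift_in M0 mu) = 1}) ->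
  forall mt, lifted_states M0 mt ->
    {ae mt, forall p, shift_in (lifted_states M0) mt (lifted_replacement p)}.
Proof.
move=> M0_Rk mt [mu M0mu mtE].
have mA : measurable (shift_in M0 mu) by exact: (measurable_shift_in dC).
have mWC : measurable (W (~` shift_in M0 mu)).
  by apply: measurable_random_signed; exact: measurableC.
exists (W (~` shift_in M0 mu)); split => //.
  rewrite mtE// -lift_measureE (lift_random_signed mu (measurableC mA)).
  rewrite -[RHS](integral0 mu setT); apply: ge0_ae_eq_integral => //.
    by apply: measurable_kernel; exact: measurableC.
  apply: filterS (M0_Rk _ M0mu) => s Rks _ /=.
  exact: (measure_setC_full mA (prob_kernel s) Rks).
move=> p /= nshift; rewrite /W /= => shift; apply: nshift.
exact/(shift_in_lift _ _ _ mtE).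
Qed.

(** By [shift_in_lift] the event that the new lifted state is in [Bt] depends only
on the unlifted replacement, and [lift_random_signed] computes its measure; a
state and its lift have the same total mass, hence the same normalisation. *)
Lemma lifted_urn_kernel mu (Bt : set (fin_measure (S * unit_itv R)%type R)) :
  M0 mu -> measurable Bt -> Bt `<=` lifted_states M0 ->
  det_urn_kernel lifted_replacement (lift_measure mu) Bt =
  random_urn_kernel Rk mu (@lift_measure _ S R @^-1` Bt).
Proof.
move=> M0mu mBt BtM0; set B := _ @^-1` Bt.
have mB : measurable B.
  by rewrite -[X in measurable X]setTI; exact: measurable_lift_measure.
have mA : measurable (shift_in B mu) by exact: (measurable_shift_in dC).
have mass0 := nonzero_mass (M0_nonzero M0mu).
have massy : mu setT \is a fin_num by exact: fin_num_measure.
have massE : lift_measure mu setT = mu setT.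
  by rewrite -setXTT lift_rect.
rewrite /det_urn_kernel (_ : [set p | _] = W (shift_in B mu)); last first.
  rewrite (lifted_states_preimage mBt BtM0) -/B.
  have liftP p := @shift_in_lift _ _ R B mu (lift_measure mu)
    (decode_part fg true (random_code f Rk p))
    (decode_part fg false (random_code f Rk p)) (fun _ _ => erefl).
  by apply/seteqP; split => p /= /liftP.
rewrite /random_urn_kernel.
have c0 : (0 <= (fine (mu setT))^-1)%R by rewrite invr_ge0 fine_ge0.
have normE (d' : measure_display) (T : measurableType d')
    (m : {measure set T -> \bar R}) (P : probability T R) A :
    m setT = mu setT -> mnormalize m P A = mscale (NngNum c0) m A.
  move=> mE; rewrite /mnormalize /mscale mE (negbTE mass0) /=.
  by rewrite lt_eqF ?ltey_eq ?massy//= muleC.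
rewrite normE// [LHS]/mscale /= lift_random_signed//.
transitivity (\int[mscale (NngNum c0) mu]_s Rk s (shift_in B mu)).
  by rewrite ge0_integral_mscale//; exact: measurable_kernel.
by apply: eq_measure_integral => A mA' _; apply/esym/normE.
Qed.

End urn.

(** * The lifted chain *)

Section histories.
Context dO (Omega : measurableType dO).

(** Inclusion of histories is checked on the generating events. *)
Lemma history_sub d1 d2 (T1 : measurableType d1) (T2 : measurableType d2)
    (X : nat -> Omega -> T1) (Y : nat -> Omega -> T2) n :
  (forall i B, measurable B -> exists2 B', measurable B' & X i @^-1` B = Y i @^-1` B') ->
  history X n `<=` history Y n.
Proof.
move=> XY; apply: sub_smallest2r; first exact: smallest_sigma_algebra.
apply: bigcup_sub => i /= ni _ [B mB <-]; rewrite setTI.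
have [B' mB' ->] := XY i B mB.
by exists i => //; exists B' => //; rewrite setTI.
Qed.

End histories.

Theorem mainTheorem2 (R : realType)
  (d : measure_display) (S : measurableType d)
  (hS : borel_space S R)
  (M0 : set (fin_measure S R))
  (mM0 : measurable M0)
  (M0_nonzero : M0 `<=` nonzero_measures (T := S) (R := R))
  (Rk : R.-pker S ~> signed_measure S R)
  (M0_Rk : forall mu, M0 mu ->
     {ae mu, forall s, Rk s (shift_in M0 mu) = 1})
  (dO : measure_display) (Omega : measurableType dO)
  (P : probability Omega R)
  (X : nat -> Omega -> fin_measure S R)
  (hX : urn_process P M0 (random_urn_kernel Rk) X) :
  exists (Rd : S * unit_itv R -> signed_measure (S * unit_itv R)%type R)
         (Xt : nat -> Omega -> fin_measure (S * unit_itv R)%type R),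
    det_urn P (lifted_states M0) Rd Xt /\
    forall n w,
      agree (Xt n w) (X n w \x leb01) /\
      agree (X n w) (pushforward (Xt n w) fst).
Proof.
have [f [g fg]] := borel_space_retract hS.
have [C dC] := borel_dense_family hS.
have [[mX X_M0 X_markov] [x0 M0x0 X0]] := hX.
pose Xt n w : fin_measure (S * unit_itv R)%type R := lift_measure (X n w).
have mlift := @measurable_lift_measure _ S R.
have mproj := @measurable_finite_image _ _ R _ _ _ (@measurable_fst _ _ S (unit_itv R)).
exists (lifted_replacement fg Rk), Xt; split; last first.
  move=> n w; split => // A mA; rewrite -(lift_measureK (X n w) mA).
  by rewrite /project_measure finite_imageE.
have mlifted := measurable_lifted_states hS mM0.
split.
- exact: borel_space_prod hS (borel_space_unit_itv R).
- split=> // mt [mu M0mu mtE] mt0; apply: (M0_nonzero _ M0mu) => A mA.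
  by rewrite -(lift_rect mu mA) lift_measureE -mtE ?mt0//; exact: measurableX.
- exact: (measurable_lifted_replacement fg dC).
- exact: (lifted_replacement_admissible fg dC mM0).
- split; last first.
    exists (lift_measure x0); first by exists x0.
    by move=> w A mA; apply: eq_lift_measure => // B mB; rewrite X0.
  split.
  + by move=> n; exact: (measurableT_comp mlift (mX n)).
  + by move=> n w; exists (X n w).
  + move=> n Bt mBt BtM0; pose B := @lift_measure _ S R @^-1` Bt.
    have mB : measurable B by rewrite -[X in measurable X]setTI; exact: mlift.
    have BM0 : B `<=` M0.
      move=> mu /BtM0 [mu' M0mu' muE]; apply: (fin_saturated mM0 _ M0mu') => A mA.
      by rewrite -(lift_rect mu' mA) -(lift_rect mu mA) muE//; exact: measurableX.
    have [Y [mY iY intY] aeY] := X_markov n B mB BM0.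
    (* Both maps are measurable, and projecting undoes lifting up to agreement. *)
    have histE : history Xt n = history X n.
      apply/seteqP; split; apply: history_sub => i D mD.
        by exists (@lift_measure _ S R @^-1` D) => //;
          rewrite -[X in measurable X]setTI; exact: mlift.
      exists (@project_measure _ S R @^-1` D).
        by rewrite -[X in measurable X]setTI; exact: mproj.
      apply/seteqP; split => w /=; apply: fin_saturated => // A mA.
        by rewrite lift_measureK.
      by rewrite lift_measureK.
    exists Y; first by rewrite /cond_prob_version histE.
    apply: filterS aeY => w ->.
    by rewrite (lifted_urn_kernel fg dC _ M0_nonzero).
Qed.
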